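(* Let $R$ be a ring and $n \ge 1$. The following are equivalent: (1) $R$ is $n$-coherent; (2) $\mathrm{FP}_n\text{-inj} = \mathrm{FP}_\infty\text{-inj}$; (3) $\mathrm{FP}_n\text{-inj} = \mathrm{FP}_{n+1}\text{-inj}$; (4) $\mathrm{FP}_n\text{-inj}$ is coresolving; (5) $({}^{\perp}(\mathrm{FP}_n\text{-inj}), \mathrm{FP}_n\text{-inj})$ is a hereditary cotorsion pair; (6) $\mathrm{Ext}^k_R(M,N)=0$ for every $k>1$, every $M\in\mathrm{FP}_n$ and every $N \in \mathrm{FP}_n\text{-inj}$. Here all modules are left $R$-modules and $\mathrm{FP}_m\text{-inj}$ denotes the class of $\mathrm{FP}_m$-injective left $R$-modules.
   Context: $R$ is an associative ring with unit. For $n \ge 0$, an $R$-module is finitely $n$-presented if there is an exact sequence $F_n \to \cdots \to F_0 \to M \to 0$ with every $F_i$ finitely generated free; $\mathrm{FP}_n$ is the class of such left modules, and $\mathrm{FP}_\infty$ the class of modules with a projective resolution by finitely generated free modules. $R$ is $n$-coherent if $\mathrm{FP}_n\subseteq\mathrm{FP}_{n+1}$. A left $R$-module $N$ is $\mathrm{FP}_m$-injective ($m\ge0$ or $m=\infty$) if $\mathrm{Ext}^1_R(F,N)=0$ for all $F\in\mathrm{FP}_m$. For a class $\mathcal C$, $\mathcal C^\perp=\{X:\mathrm{Ext}^1_R(C,X)=0\ \forall C\in\mathcal C\}$, ${}^\perp\mathcal C=\{X:\mathrm{Ext}^1_R(X,C)=0\ \forall C\in\mathcal C\}$; $(\mathcal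 A,\mathcal B)$ is a cotorsion pair if $\mathcal A^\perp=\mathcal B$ and ${}^\perp\mathcal B=\mathcal A$; it is hereditary if $\mathrm{Ext}^i_R(A,B)=0$ for all $i>0$, $A\in\mathcal A$, $B\in\mathcal B$. A class $\mathcal B$ is coresolving if it contains all injective modules and is closed under extensions and under cokernels of monomorphisms. *)

(* Defs.v *)
From HB Require Import structures.
From mathcomp Require Import all_boot all_order all_algebra.
Set Implicit Arguments. Unset Strict Implicit. Unset Printing Implicit Defensive.
Import GRing.Theory.
Local Open Scope ring_scope.

Section Homological.
Variable R : pzRingType.

Definition mclass := forall M : lmodType R, Prop.

Definition exact_at (A B C : lmodType R) (f : A -> B) (g : B -> C) : Prop :=
  forall b : B, g b = 0 <-> exists a : A, f a = b.

Definition surj (A B : Type) (f : A -> B) : Prop := forall b, exists a, f a = b.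

Definition FP (n : nat) : mclass := fun M =>
  exists (m : nat -> nat) (d : forall i, {linear 'rV[R]_(m i.+1) -> 'rV[R]_(m i)})
         (e : {linear 'rV[R]_(m 0%N) -> M}),
    [/\ surj e, (0 < n)%N -> exact_at (d 0%N) e
      & forall i, (i.+1 < n)%N -> exact_at (d i.+1) (d i)].

Definition FPinf : mclass := fun M =>
  exists (m : nat -> nat) (d : forall i, {linear 'rV[R]_(m i.+1) -> 'rV[R]_(m i)})
         (e : {linear 'rV[R]_(m 0%N) -> M}),
    [/\ surj e, exact_at (d 0%N) e & forall i, exact_at (d i.+1) (d i)].

Definition projective (P : lmodType R) : Prop :=
  forall (A B : lmodType R) (g : {linear A -> B}) (f : {linear P -> B}),
    surj g -> exists h : {linear P -> A}, forall x, g (h x) = f x.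

Definition injective_mod (N : lmodType R) : Prop :=
  forall (A B : lmodType R) (f : {linear A -> B}) (g : {linear A -> N}),
    injective f -> exists h : {linear B -> N}, forall x, h (f x) = g x.

Definition proj_resolution (M : lmodType R) (P : nat -> lmodType R)
  (d : forall i, {linear P i.+1 -> P i}) (e : {linear P 0%N -> M}) : Prop :=
  [/\ forall i, projective (P i), surj e, exact_at (d 0%N) e
    & forall i, exact_at (d i.+1) (d i)].

(* Ext^k_R(M,N) = 0, computed from (any, equivalently every) projective
   resolution P of M as the k-th cohomology of Hom_R(P,N): every k-cocycle
   is a coboundary. *)
Definition Ext_zero (k : nat) (M N : lmodType R) : Prop :=
  forall (P : nat -> lmodType R) (d : forall i, {linear P i.+1 -> P i})
         (e : {linear P 0%N -> M}),
    proj_resolution d e ->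
    forall f : {linear P k -> N}, (forall x, f (d k x) = 0) ->
      match k return {linear P k -> N} -> Prop with
      | 0%N => fun f => forall x, f x = 0
      | j.+1 => fun f => exists g : {linear P j -> N}, forall x, f x = g (d j x)
      end f.

Definition Cinj (C : mclass) : mclass := fun N => forall F, C F -> Ext_zero 1 F N.

Definition perp_right (C : mclass) : mclass := fun X => forall A, C A -> Ext_zero 1 A X.
Definition perp_left (C : mclass) : mclass := fun X => forall B, C B -> Ext_zero 1 X B.

Definition same_class (C D : mclass) : Prop := forall M, C M <-> D M.

Definition short_exact (A E C : lmodType R) (i : {linear A -> E}) (p : {linear E -> C}) :=
  [/\ injective i, exact_at i p & surj p].

Definition coresolving (B : mclass) : Prop :=
  [/\ forall N, injective_mod N -> B N,
      forall (A E C : lmodType R) (i : {linear A -> E}) (p : {linear E -> C}),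
        short_exact i p -> B A -> B C -> B E
    & forall (A E C : lmodType R) (i : {linear A -> E}) (p : {linear E -> C}),
        short_exact i p -> B A -> B E -> B C].

Definition cotorsion_pair (A B : mclass) : Prop :=
  same_class (perp_right A) B /\ same_class (perp_left B) A.

Definition hereditary_cotorsion_pair (A B : mclass) : Prop :=
  cotorsion_pair A B /\
  forall (i : nat) (X N : lmodType R), (0 < i)%N -> A X -> B N -> Ext_zero i X N.

Definition n_coherent (n : nat) : Prop := forall M, FP n M -> FP n.+1 M.

End Homological.

Arguments FP : clear implicits.
Arguments FPinf : clear implicits.
Arguments Ext_zero : clear implicits.
Arguments Cinj : clear implicits.
Arguments perp_left : clear implicits.
Arguments perp_right : clear implicits.
Arguments same_class : clear implicits.
Arguments coresolving : clear implicits.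
Arguments hereditary_cotorsion_pair : clear implicits.
Arguments n_coherent : clear implicits.

(* Main.v *)
From HB Require Import structures.
From mathcomp Require Import all_boot all_order all_algebra.
From mathcomp Require Import ring_quotient finmap.
From mathcomp Require Import boolp classical_sets functions fsbigop.
Require Import Defs.
Set Implicit Arguments. Unset Strict Implicit. Unset Printing Implicit Defensive.
Import GRing.Theory Num.Theory.
Local Open Scope ring_scope.

(** The vanishing of [Ext^k] is rewritten as an extension property along any
    presentation by a projective, which makes dimension shifting formal; this
    needs enough projectives.  Under (1) every syzygy of an [FP_n] module is
    again [FP_n], so [FP_n = FP_oo].  For (3) => (4), a module in [FP_{n+1}] has
    a first syzygy in [FP_n], which kills the obstruction [Ext^2(M, A)].  For
    (4) => (5), embedding a module into an injective one and using that the
    cokernel stays in the class shows that the left orthogonal is closed under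
    syzygies.  For (6) => (1), dimension shifting reduces to showing that a
    finitely generated [F/L], with [F] free of finite rank, is finitely presented
    once [Ext^1(F/L, N) = 0] for all [FP_1]-injective [N].  Let [W] be the
    injective cogenerator [Hom_Z(R, Q/Z)] and let [N] be the module of the
    families [y] in [W^Hom(L, W)] for which some finitely generated submodule
    [L0] of [L] satisfies [y_h = 0] whenever [h] kills [L0].  As a directed union
    of injectives, [N] is [FP_1]-injective, so the evaluation map [L -> N] extends
    to [F]; finitely many generators of [F] share one [L0], hence every [h]
    killing [L0] is zero and [L = L0]. *)

(** * Submodules, kernels, images and factorizations of linear maps *)

Section Submodules.
Variable R : pzRingType.
Implicit Types A B C K M N P Q V : lmodType R.

Definition lin_of A B (f : A -> B) (fl : linear f) : {linear A -> B} :=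
  HB.pack f (GRing.isLinear.Build R A B _ f fl).

Definition lin_closed V (S : V -> Prop) : Prop :=
  S 0 /\ forall a u v, S u -> S v -> S (a *: u + v).

(** Taking the closure proof as an argument lets the submodule structure be inferred from the
    predicate alone. *)
Definition mem_sub V (S : V -> Prop) (_ : lin_closed S) : {pred V} :=
  fun x => `[< S x >].

Lemma mem_sub_closed V (S : V -> Prop) (cS : lin_closed S) :
  submod_closed (mem_sub cS).
Proof.
case: (cS) => S0 SD; split; first exact/asboolP.
by move=> a u v /asboolP Su /asboolP Sv; apply/asboolP/SD.
Qed.

HB.instance Definition _ V (S : V -> Prop) (cS : lin_closed S) :=
  GRing.isSubmodClosed.Build R V (mem_sub cS) (mem_sub_closed cS).

Definition sub_mod V (S : V -> Prop) (cS : lin_closed S) :=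
  {x : V | x \in mem_sub cS}.

HB.instance Definition _ V (S : V -> Prop) (cS : lin_closed S) :=
  SubChoice.on (sub_mod cS).
HB.instance Definition _ V (S : V -> Prop) (cS : lin_closed S) :=
  [SubChoice_isSubLmodule of sub_mod cS by <:].

Lemma submodule_exists V (S : V -> Prop) : lin_closed S ->
  exists (A : lmodType R) (i : {linear A -> V}),
    injective i /\ forall x, S x <-> exists a, i a = x.
Proof.
move=> cS; exists (sub_mod cS : lmodType R), (\val : {linear _ -> V}).
split; first exact: val_inj.
move=> x; split=> [Sx|[a <-]]; last exact/asboolP/(valP a).
have Sx' : x \in mem_sub cS by exact/asboolP.
by exists (Sub x Sx').
Qed.

Lemma lift_inj A B V (i : {linear A -> V}) (f : {linear B -> V}) :
  injective i -> (forall b, exists a, i a = f b) ->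
  exists g : {linear B -> A}, forall b, i (g b) = f b.
Proof.
move=> injI /choice[g gE].
have gl : linear g by move=> a x y; apply: injI; rewrite linearP !gE linearP.
by exists (lin_of gl).
Qed.

Lemma factor_surj A B C (q : {linear A -> B}) (f : {linear A -> C}) :
  surj q -> (forall a, q a = 0 -> f a = 0) ->
  exists g : {linear B -> C}, forall a, g (q a) = f a.
Proof.
move=> /choice[s sE] kf.
have fE x y : q x = q y -> f x = f y.
  by move=> e; apply/subr0_eq; rewrite -linearB; apply: kf; rewrite linearB e subrr.
have gl : linear (fun b => f (s b)).
  by move=> a x y; rewrite -linearP; apply: fE; rewrite linearP !sE.
by exists (lin_of gl) => a /=; apply: fE.
Qed.

Lemma ker_ses P M (p : {linear P -> M}) : surj p ->
  exists (K : lmodType R) (i : {linear K -> P}), short_exact i p.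
Proof.
move=> sp; have [|K [i [inji iE]]] := @submodule_exists P (fun x => p x = 0).
  by split=> [|a u v u0 v0]; rewrite ?linear0 // linearP u0 v0 scaler0 addr0.
by exists K, i; split.
Qed.

Lemma im_factor A B (f : {linear A -> B}) :
  exists (C : lmodType R) (q : {linear A -> C}) (i : {linear C -> B}),
    [/\ surj q, injective i & forall a, i (q a) = f a].
Proof.
have [|C [i [inji iE]]] := @submodule_exists B (fun y => exists a, f a = y).
  split=> [|a _ _ [u <-] [v <-]]; first by exists 0; rewrite linear0.
  by exists (a *: u + v); rewrite linearP.
have [|q qE] := @lift_inj C A B i f inji; first by move=> b; apply/iE; exists b.
exists C, q, i; split=> // c.
have /iE[a fa] : exists a, i a = i c by exists c.
by exists a; apply: inji; rewrite qE.
Qed.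

End Submodules.

(** * Free modules, projective covers by them, and resolutions *)

Section Projectives.
Variable R : pzRingType.
Implicit Types A B C K M N P Q V : lmodType R.

Definition is_basis (T : Type) P (b : T -> P) : Prop :=
  (forall A (a : T -> A), exists h : {linear P -> A}, forall t, h (b t) = a t) /\
  (forall A (g h : {linear P -> A}), (forall t, g (b t) = h (b t)) -> g =1 h).

Lemma basis_projective (T : Type) P (b : T -> P) : is_basis b -> projective P.
Proof.
move=> [ext uni] A B g f /choice[s sE].
have [h hE] := ext A (fun t => s (f (b t))).
by exists h => x; apply: (uni B (g \o h) f) => t /=; rewrite hE sE.
Qed.

Lemma row_basis m : is_basis (fun j => delta_mx 0 j : 'rV[R]_m).
Proof.
split=> [A a|A g h gh v].
  have hl : linear (fun v : 'rV[R]_m => \sum_j v 0 j *: a j).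
    move=> c u v; rewrite scaler_sumr -big_split /=; apply: eq_bigr => j _.
    by rewrite !mxE scalerDl scalerA.
  exists (lin_of hl) => j /=; rewrite (bigD1 j) //= big1 ?addr0 => [|k kj].
    by rewrite mxE !eqxx scale1r.
  by rewrite mxE eqxx (negPf kj) scale0r.
rewrite (row_sum_delta v) !linear_sum; apply: eq_bigr => j _.
by rewrite !linearZ /= gh.
Qed.

Lemma row_projective m : projective 'rV[R]_m.
Proof. exact: basis_projective (row_basis m). Qed.

(** The finitely supported functions from [T] to [R], with the indicator functions as basis; maps
    out of it are given by sums over a finite set containing the support. *)
Lemma free_exists (T : choiceType) : exists P (b : T -> P), is_basis b.
Proof.
pose S (f : T -> R^o) := exists s : {fset T}, forall t, t \notin s -> f t = 0.
have [|P [i [inji iP]]] := @submodule_exists R (T -> R^o) S.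
  split=> [|a u v [s s0] [r r0]]; first by exists fset0.
  exists (s `|` r)%fset => t; rewrite inE negb_or => /andP[ts tr].
  by rewrite /= /GRing.add /GRing.scale /= s0 // r0 // scaler0 addr0.
have /choice[b bE] t : exists x, i x = (fun t' => (t' == t)%:R).
  apply/iP; exists [fset t]%fset => t'; rewrite inE => /negPf tt'.
  by rewrite tt'.
have supp x : S (i x) by apply/iP; exists x.
have sumE A (F : T -> A) (s : {fset T}) : (forall t, t \notin s -> F t = 0) ->
    \sum_(t \in [set: T]) F t = \sum_(t <- s) F t.
  by move=> F0; apply: fsbigTE.
exists P, b; split=> [A a|A g h gh x].
  have hl : linear (fun x => \sum_(t \in [set: T]) (i x t : R) *: a t).
    move=> c x y; have [s s0] := supp x; have [r r0] := supp y.
    have z0 z t : i z t = 0 -> (i z t : R) *: a t = 0 by move=> ->; rewrite scale0r.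
    have suE z : (forall t, t \notin (s `|` r)%fset -> i z t = 0) ->
        \sum_(t \in [set: T]) (i z t : R) *: a t
          = \sum_(t <- (s `|` r)%fset) (i z t : R) *: a t.
      by move=> i0; apply: sumE => t /i0; exact: z0.
    rewrite !suE; do ?[move=> t; rewrite inE negb_or => /andP[ts tr];
      rewrite ?linearP ?s0 ?r0 //= /GRing.add /GRing.scale /= s0 // r0 //;
      by rewrite scaler0 addr0].
    rewrite scaler_sumr -big_split /=; apply: eq_bigr => t _.
    by rewrite linearP scalerA -scalerDl.
  exists (lin_of hl) => t /=; rewrite (sumE _ _ [fset t]%fset) => [|t'].
    by rewrite big_seq_fset1 bE eqxx scale1r.
  by rewrite inE bE => /negPf->; rewrite scale0r.
have [s s0] := supp x.
have -> : x = \sum_(t <- s) (i x t : R) *: b t.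
  apply: inji; rewrite linear_sum; apply/funext => t; rewrite fct_sumE.
  have [ts|ts] := boolP (t \in s).
    rewrite (big_fsetD1 t) //= big_seq big1 ?addr0 => [|u]; last first.
      rewrite !inE => /andP[ut _]; rewrite linearZ /= /GRing.scale /= bE.
      by rewrite eq_sym (negPf ut) /GRing.scale /= mulr0.
    by rewrite linearZ /= /GRing.scale /= bE eqxx /GRing.scale /= mulr1.
  rewrite s0 // big_seq big1 // => u us.
  rewrite linearZ /= /GRing.scale /= bE.
  case: eqP => [tu|_]; first by rewrite tu us in ts.
  by rewrite /GRing.scale /= mulr0.
by rewrite !linear_sum; apply: eq_bigr => t _; rewrite !linearZ /= gh.
Qed.

Lemma enough_projectives M : exists P (p : {linear P -> M}), projective P /\ surj p.
Proof.
have [P [b bP]] := free_exists M; have [p pE] := bP.1 M id.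
by exists P, p; split=> [|x]; [exact: basis_projective bP | exists (b x)].
Qed.

(** Splices presentations chosen for the successive syzygies. Keeping [F] and [X] general yields
    both projective resolutions and resolutions by finitely generated free modules. *)
Lemma resolution_exists (J : Type) (F : J -> lmodType R) (X : mclass R) M :
  (forall L, X L -> exists j (p : {linear F j -> L}) K (i : {linear K -> F j}),
     short_exact i p /\ X K) ->
  X M ->
  exists (m : nat -> J) (d : forall k, {linear F (m k.+1) -> F (m k)})
         (e : {linear F (m 0%N) -> M}),
    [/\ surj e, exact_at (d 0%N) e & forall k, exact_at (d k.+1) (d k)].
Proof.
move=> step XM.
(* The choices are packed into sigma types so that [next], which sends a module in [X] to its chosen
   kernel, can be iterated. *)
have st (s : {L | X L}) : {j & {p : {linear F j -> sval s} & {K : lmodType R &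
    {i : {linear K -> F j} | short_exact i p /\ X K}}}}.
  have /cid[j /cid[p /cid[K /cid[i h]]]] := step _ (svalP s).
  by exists j, p, K, i.
pose next s : {L | X L} := let: existT _ (existT _ (existT K (exist _ h))) := st s
  in exist _ K h.2.
pose s k := iter k next (exist _ M XM).
pose m k := projT1 (st (s k)).
pose p k : {linear F (m k) -> sval (s k)} := projT1 (projT2 (st (s k))).
have i_ k : {i : {linear sval (s k.+1) -> F (m k)} | short_exact i (p k)}.
  rewrite /s iterS -/(s k) /p /m /next.
  by case: (st (s k)) => j [q [K [i h]]] /=; exists i; case: h.
pose i k := sval (i_ k); have iP k : short_exact (i k) (p k) := svalP (i_ k).
have ex k (Q : lmodType R) (f : {linear F (m k) -> Q}) :
    (forall x, f x = 0 <-> p k x = 0) ->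
    exact_at (i k \o p k.+1 : {linear _ -> _}) f.
  move=> fE y; rewrite fE; have [_ ex _] := iP k; rewrite ex.
  split=> [[a <-]|[a <-]]; last by exists (p k.+1 a).
  by have [_ _ /(_ a)[x <-]] := iP k.+1; exists x.
exists m, (fun k => i k \o p k.+1 : {linear _ -> _}), (p 0%N); split.
- by have [] := iP 0%N.
- exact: ex.
- move=> k; apply: ex => x /=; split=> [|->]; last by rewrite linear0.
  by have [inj _ _] := iP k; rewrite -[RHS](linear0 (i k)) => /inj.
Qed.

Lemma proj_resolution_exists M : exists (P : nat -> lmodType R)
  (d : forall k, {linear P k.+1 -> P k}) (e : {linear P 0%N -> M}),
  proj_resolution d e.
Proof.
have [L _|//|m [d [e [se e0 ek]]]] :=
    @resolution_exists {P | projective P} sval (fun=> True) M.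
  have [P [p [prP sp]]] := enough_projectives L; have [K [i ip]] := ker_ses sp.
  by exists (exist _ P prP), p, K, i.
by exists (fun k => sval (m k)), d, e; split=> // k; exact: (svalP (m k)).
Qed.

End Projectives.

(** * Vanishing of Ext through presentations and dimension shifting *)

Section Ext.
Variable R : pzRingType.
Implicit Types A B C K M N P Q V : lmodType R.

Definition ext1z M N : Prop := forall P K (i : {linear K -> P}) (p : {linear P -> M}),
  projective P -> short_exact i p ->
  forall f : {linear K -> N}, exists g : {linear P -> N}, forall x, g (i x) = f x.

(** The index is shifted by one: [extz k] stands for the vanishing of Ext in degree [k.+1], which is
    degree [k] on a syzygy. *)
Fixpoint extz k M N : Prop := if k is k'.+1 then
    forall P K (i : {linear K -> P}) (p : {linear P -> M}),
      projective P -> short_exact i p -> extz k' K N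
  else ext1z M N.

(** Comparison maps [a] and [b] over [M] satisfy [1 = a \o b + i' \o v], so an extension [g] of
    [f' \o u], transported by [b] and corrected by [f' \o v], extends [f']. *)
Lemma ext1z_of_presentation M N P K (i : {linear K -> P}) (p : {linear P -> M}) :
  projective P -> short_exact i p ->
  (forall f : {linear K -> N}, exists g : {linear P -> N}, forall x, g (i x) = f x) ->
  ext1z M N.
Proof.
move=> prP [inji exi sp] ext P' K' i' p' prP' [inji' exi' sp'] f'.
have [a aE] := prP _ _ p' p sp'; have [b bE] := prP' _ _ p p' sp.
have [|u uE] := @lift_inj _ _ _ _ i' (a \o i) inji'.
  by move=> x; apply/exi'; rewrite /= aE; apply/exi; exists x.
have [g gE] := ext (f' \o u).
have [|v vE] := @lift_inj _ _ _ _ i' (idfun \- (a \o b)) inji'.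
  by move=> x; apply/exi'; rewrite /= linearB /= aE bE subrr.
exists ((g \o b) \+ (f' \o v)) => x /=.
have [|y yE] := (exi (b (i' x))).1; first by rewrite bE; apply/exi'; exists x.
rewrite -yE gE /= -linearD; congr (f' _); apply: inji'.
by rewrite linearD uE vE /= yE addrC subrK.
Qed.

(** The first differential corestricts to a surjection [q] onto the syzygy [K]: a 1-cocycle factors
    through [K], and in higher degree the truncated resolution resolves [K]. *)
Lemma extz_Ext_zero k M N : extz k M N -> Ext_zero R k.+1 M N.
Proof.
elim: k M => [|k IH] M eMN P d e [prP se e0 ek] f fd;
  have [K [i ip]] := ker_ses se; have [inji exi _] := ip;
  have [|q qE] := @lift_inj _ _ _ _ i (d 0%N) inji;
  do ?[by move=> x; apply/exi/e0; exists x];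
  have sq : surj q by
    [move=> y; have /exi/e0[a da] : exists x, i x = i y by [exists y];
     exists a; apply: inji; rewrite qE];
  have q0 x : q x = 0 <-> d 0%N x = 0 by
    [rewrite -qE; split=> [->|];
     [exact: linear0 | rewrite -[RHS](linear0 i); exact: inji]].
- have [|h hE] := @factor_surj _ _ _ _ q f sq.
    by move=> a /q0/ek[b <-]; exact: fd.
  have [g gE] := eMN _ _ _ _ (prP 0%N) ip h.
  by exists g => x; rewrite -qE gE hE.
- apply: (IH K (eMN _ _ _ _ (prP 0%N) ip) (fun k => P k.+1) (fun k => d k.+1) q) => //.
  by split=> // x; rewrite q0; exact: ek.
Qed.

Lemma splice_resolution M P K (i : {linear K -> P}) (p : {linear P -> M})
    (Q : nat -> lmodType R) (d : forall k, {linear Q k.+1 -> Q k})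
    (e : {linear Q 0%N -> K}) :
  projective P -> short_exact i p -> proj_resolution d e ->
  proj_resolution (P := fun k => if k is k'.+1 then Q k' else P)
    (fun k => match k with 0%N => i \o e : {linear _ -> _} | k'.+1 => d k' end) p.
Proof.
move=> prP [inji exi sp] [prQ se e0 ek]; split=> //.
- by case.
- move=> x; rewrite exi; split=> [[y <-]|[y <-]]; last by exists (e y).
  by have [z <-] := se y; exists z.
- case=> [x|k]; last exact: ek.
  rewrite -e0 /=; split=> [|->]; last exact: linear0.
  by rewrite -[RHS](linear0 i) => /inji.
Qed.

(** A resolution of the syzygy prefixed by [P] resolves [M], so a cocycle for the syzygy is one for
    [M] a degree higher. *)
Lemma Ext_zero_extz k M N : Ext_zero R k.+1 M N -> extz k M N.
Proof.
elim: k M => [|k IH] M eMN P K i p prP ip.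
  move=> f; have [Q [d [e res]]] := proj_resolution_exists K.
  have [prQ se e0 ek] := res.
  have [|g gE] := eMN _ _ _ (splice_resolution prP ip res) (f \o e).
    by move=> x /=; rewrite (e0 _).2 ?linear0 //; exists x.
  by exists g => x; have [y <-] := se x; exact: (esym (gE y)).
apply: IH => Q d e res f fd.
exact: (eMN _ _ _ (splice_resolution prP ip res) f fd).
Qed.

Lemma Ext_zero1P M N : Ext_zero R 1 M N <-> ext1z M N.
Proof. by split; [exact: (@Ext_zero_extz 0) | exact: (@extz_Ext_zero 0)]. Qed.

End Ext.

(** * The group Q/Z and extension of additive maps into divisible groups *)

Section Divisible.

Definition rat_int : {pred rat} := fun x => x \is a Num.int.

Lemma rat_int_closed : zmod_closed rat_int.
Proof. by split=> [|x y]; [exact: rpred0 | exact: rpredB]. Qed.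

HB.instance Definition _ := GRing.isZmodClosed.Build rat rat_int rat_int_closed.

Lemma QmodZ_exists : exists (D : zmodType) (q : {additive rat -> D}),
  surj q /\ forall x, q x = 0 <-> x \is a Num.int.
Proof.
pose q x : Quotient.quot rat_int := (\pi x)%qT.
have ql : zmod_morphism q by move=> x y; rewrite /q raddfB.
pose q' : {additive rat -> Quotient.quot rat_int} :=
  HB.pack q (GRing.isZmodMorphism.Build _ _ q ql).
exists (Quotient.quot rat_int), q'; split=> [y|x].
  by exists (repr y); rewrite /= /q reprK.
have := Quotient.idealrBE rat_int x 0; rewrite subr0.
rewrite -[_ \in _]/(x \is a Num.int) => ->.
have -> : (q' x = 0) = (q' x = q' 0) by rewrite raddf0.
by split=> /eqP.
Qed.

(** Q/Z serves. Here [m] will generate the ideal of multiples of a point lying in a subgroup, so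
    [m = 0] must be covered: it means that the value at the point is unconstrained. *)
Lemma divisible_cogenerator_exists : exists D : zmodType,
  (forall (m : int) (d : D), (m = 0 -> d = 0) -> exists c, c *~ m = d) /\
  (forall m : int, `|m| != 1 -> exists c : D, c != 0 /\ c *~ m = 0).
Proof.
have [D [q [sq q0]]] := QmodZ_exists; exists D; split=> [m d m0|m m1].
  have [/m0->|nm] := eqVneq m 0; first by exists 0; rewrite mul0rz.
  have [x <-] := sq d; exists (q (x / m%:~R)).
  by rewrite -raddfMz -mulrzr mulfVK // intr_eq0.
have qV (k : int) : k != 0 -> `|k| != 1 -> q k%:~R^-1 != 0.
  move=> nk; apply: contra => /eqP/q0/intrP[l].
  move=> /(congr1 (fun x : rat => x * k%:~R)); rewrite mulVf ?intr_eq0 //.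
  rewrite -intrM -[1]/(1%:~R) => /intr_inj kl.
  have : (k %| 1)%Z by apply/dvdzP; exists l.
  by rewrite dvdz1 -abszE => /eqP->.
have [->|nm] := eqVneq m 0.
  (* For [m = 0] any nonzero class will do, such as that of 1/2. *)
  by exists (q 2%:~R^-1); rewrite mulr0z; split=> //; exact: qV.
exists (q m%:~R^-1); split; first exact: qV.
by rewrite -raddfMz -mulrzr mulVf ?intr_eq0 //; apply/q0; rewrite int_num1.
Qed.

Definition subgroup (L : zmodType) (S : L -> Prop) : Prop :=
  S 0 /\ forall x y, S x -> S y -> S (x - y).

Lemma subgroup_mulrz (L : zmodType) (S : L -> Prop) x k :
  subgroup S -> S x -> S (x *~ k).
Proof.
move=> [S0 SB] Sx; have SN y : S y -> S (- y) by move=> /(SB _ _ S0); rewrite sub0r.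
have Sn n : S (x *+ n).
  elim: n => [|n IH]; first by rewrite mulr0n.
  by rewrite mulrSr -[x in _ + x]opprK; exact: SB IH (SN _ Sx).
by case: k => n; [exact: Sn | rewrite NegzE mulrNz; exact/SN/Sn].
Qed.

(** The least positive such multiple generates them all by Euclidean division; the generator is 0
    when there is none. *)
Lemma multiples_in_subgroup (L : zmodType) (S : L -> Prop) x :
  subgroup S -> exists m : int, forall k, S (x *~ k) <-> (m %| k)%Z.
Proof.
move=> gS; have [S0 SB] := gS.
have [ex|nex] := pselect (exists m : nat, (0 < m)%N && `[< S (x *~ m) >]).
  case: (ex_minnP ex) => m /andP[m0 /asboolP Sm] mmin; exists m => k; split.
    move=> Sk; apply/dvdzP; exists (k %/ m)%Z; rewrite [LHS](divz_eq k m).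
    suff -> : (k %% m)%Z = 0 by rewrite addr0.
    have Sr : S (x *~ (k %% m)%Z).
      rewrite /modz mulrzBr; apply: SB => //.
      by rewrite [(_ * _)%R]mulrC mulrzA; exact: subgroup_mulrz.
    have : (0 <= (k %% m)%Z) by apply: modz_ge0; rewrite -lt0n.
    have : ((k %% m)%Z < m) by apply: ltz_pmod.
    case: (k %% m)%Z Sr => // r Sr rm _.
    case: (posnP r) => [-> //|r0].
    have /mmin : (0 < r)%N && `[< S (x *~ r) >] by rewrite r0; exact/asboolP.
    by rewrite leqNgt -ltz_nat rm.
  by move=> /dvdzP[q ->]; rewrite mulrC mulrzA; exact: subgroup_mulrz.
exists 0 => k; rewrite dvd0z; split=> [Sk|/eqP->]; last by rewrite mulr0z.
apply/eqP; apply: contrapT => k0; apply: nex; exists `|k|%N.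
rewrite absz_gt0; apply/andP; split; first exact/eqP.
apply/asboolP; rewrite abszEsg mulrC mulrzA; exact: subgroup_mulrz.
Qed.

(** A homomorphism from a subgroup of [L] to [D], encoded by its graph so that extension is
    inclusion and chains have unions. *)
Definition partial_hom (L D : zmodType) (G : (L * D)%type -> Prop) : Prop :=
  subgroup G /\ forall d, G (0, d) -> d = 0.

(** The value [c] agrees with [G] on the multiples of [x] already in its domain, which keeps the
    enlarged graph single valued. *)
Lemma partial_hom_add_point (L D : zmodType) (G : (L * D)%type -> Prop) x c :
  partial_hom G -> (forall k, (exists d, G (x *~ k, d)) -> G (x *~ k, c *~ k)) ->
  partial_hom (fun z => exists u k, G u /\ z = u + (x, c) *~ k).
Proof.
move=> [[G0 GB] Gf] xc; have mzE k : (x, c) *~ k = (x *~ k, c *~ k).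
  by rewrite [LHS]surjective_pairing !raddfMz.
split; first split.
- by exists 0, 0; rewrite mulr0z addr0.
- move=> _ _ [u [k [Gu ->]]] [v [l [Gv ->]]]; exists (u - v), (k - l); split.
    exact: GB.
  by rewrite mulrzBr opprD addrACA.
- move=> d [u [k [Gu]]]; rewrite mzE => e.
  have uE : u = (x *~ (- k), d + c *~ (- k)).
    apply: (addIr (x *~ k, c *~ k)); rewrite -e; congr pair; rewrite /=.
      by rewrite mulrNz addNr.
    by rewrite mulrNz subrK.
  rewrite uE in Gu; have := GB _ _ Gu (xc _ (ex_intro _ _ Gu)).
  rewrite -[X in G X]/(x *~ - k - x *~ - k, d + c *~ - k - c *~ - k).
  by rewrite subrr addrK => /Gf.
Qed.

(** Zorn: a maximal graph is total, since divisibility would supply a compatible value at any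
    missing point. *)
Lemma partial_hom_extends (L D : zmodType) (G : (L * D)%type -> Prop) :
  (forall (m : int) (d : D), (m = 0 -> d = 0) -> exists c, c *~ m = d) ->
  partial_hom G ->
  exists f : L -> D, zmod_morphism f /\ forall x d, G (x, d) -> f x = d.
Proof.
move=> divD pG.
(* Adjoining [G] to each set, rather than asking that it contain [G], also bounds the empty
   chain. *)
have [|A [pA Amax]] := @Zorn_bigcup (L * D)%type
    (fun X => partial_hom (fun z => X z \/ G z)).
  move=> F FP tot; have [[G0 GB] Gf] := pG.
  have inF X : F X -> partial_hom (fun z => X z \/ G z) by move/FP.
  have sub X u v : F X -> X u \/ G u -> X v \/ G v ->
      (\bigcup_(Y in F) Y)%classic (u - v) \/ G (u - v).
    move=> FX Xu Xv; have [|] := (inF _ FX).1.2 u v Xu Xv; last by right.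
    by left; exists X.
  split; first split; first by right.
    move=> u v [[X FX Xu]|Gu] [[Y FY Yv]|Gv]; last by right; exact: GB.
    - have [XY|YX] := tot _ _ FX FY.
        by apply: (sub Y) => //; left; [exact: XY|].
      by apply: (sub X) => //; left; [|exact: YX].
    - by apply: (sub X) => //; [left|right].
    - by apply: (sub Y) => //; [right|left].
  move=> d [[X FX Xd]|]; last exact: Gf.
  by apply: (inF _ FX).2; left.
set H := fun z => A z \/ G z in pA.
have tot x : exists d, H (x, d).
  apply: contrapT => nx.
  (* The value [c] at [x] need only satisfy [c *~ m = d], where [d] is the value already fixed at
     [x *~ m]. *)
  have [|m mE] := @multiples_in_subgroup L (fun y => exists d, H (y, d)) x.
    have [[H0 HB] _] := pA; split; first by exists 0.
    move=> y z [d Hd] [e He]; exists (d - e); exact: (HB _ _ Hd He).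
  have [d Hd] := (mE m).2 (dvdzz m).
  have [|c cE] := divD m d.
    by move=> m0; apply: pA.2; rewrite m0 mulr0z in Hd.
  have [|B1 B2] := @partial_hom_add_point L D H x c pA.
    move=> k /mE/dvdzP[q ->]; rewrite ![q * m]mulrC !mulrzA cE.
    have := subgroup_mulrz q pA.1 Hd.
    by rewrite [(_, _) *~ _]surjective_pairing !raddfMz.
  set B := (fun z => _) in B1 B2.
  have HB z : H z -> B z by move=> Hz; exists z, 0; rewrite mulr0z addr0.
  have Bx : B (x, c) by exists 0, 1; rewrite add0r mulr1z; split=> //; exact: pA.1.1.
  apply: (Amax B); last first.
    have -> // : (fun z => B z \/ G z) = B.
    apply/funext=> z; apply/propext; split; last by left.
    by case=> // Gz; apply: HB; right.
  split=> [z Az|BA]; first by apply: HB; left.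
  by apply: nx; exists c; left; exact: BA.
have [[H0 HB] Hf] := pA.
have [f fE] := choice tot.
have uni x d : H (x, d) -> f x = d.
  move=> Hd; apply/subr0_eq/Hf; have := HB _ _ (fE x) Hd.
  by rewrite -[X in H X]/(x - x, f x - d) subrr.
exists f; split=> [x y|x d Gd]; last by apply: uni; right.
exact/uni/(HB _ _ (fE x) (fE y)).
Qed.

End Divisible.

Lemma zmod_morphismD (U V : zmodType) (f : U -> V) :
  zmod_morphism f -> {morph f : x y / x + y}.
Proof.
move=> fB x y; have f0 : f 0 = 0 by rewrite -(subrr 0) fB subrr.
by rewrite -[y in LHS]opprK fB -[- y]sub0r fB f0 sub0r opprK.
Qed.

(** * The coinduced module, cokernels and enough injectives *)

Section Injectives.
Variable R : pzRingType.
Implicit Types A B C K M N P Q V : lmodType R.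

Definition add_map (D : zmodType) : {pred R -> D} :=
  fun f => `[< zmod_morphism f >].

Lemma add_map_closed D : zmod_closed (@add_map D).
Proof.
split=> [|f g /asboolP fB /asboolP gB]; apply/asboolP => x y /=.
  by rewrite /GRing.zero /= subr0.
rewrite -[LHS]/(f (x - y) - g (x - y)) -[RHS]/(f x - g x - (f y - g y)) fB gB.
by rewrite !opprD !opprK addrACA.
Qed.

HB.instance Definition _ (D : zmodType) :=
  GRing.isZmodClosed.Build (R -> D) (@add_map D) (@add_map_closed D).

Definition homZ (D : zmodType) := {f : R -> D | f \in @add_map D}.

HB.instance Definition _ (D : zmodType) := SubChoice.on (homZ D).
HB.instance Definition _ (D : zmodType) := [SubChoice_isSubZmodule of homZ D by <:].

Section Scale.
Variable D : zmodType.

Lemma homZ_additive (f : homZ D) : zmod_morphism (val f).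
Proof. exact/asboolP/(valP f). Qed.

Lemma homZ_scale_subproof (a : R) (f : homZ D) :
  (fun r => val f (r * a)) \in @add_map D.
Proof. by apply/asboolP => x y; rewrite mulrBl homZ_additive. Qed.

(** Right multiplication inside the argument is what gives a left action. *)
Definition homZ_scale (a : R) (f : homZ D) : homZ D :=
  Sub (fun r => val f (r * a)) (homZ_scale_subproof a f).

Lemma homZ_scaleA a b (f : homZ D) :
  homZ_scale a (homZ_scale b f) = homZ_scale (a * b) f.
Proof. by apply: val_inj; apply/funext => r /=; rewrite mulrA. Qed.

Lemma homZ_scale1 : left_id 1 homZ_scale.
Proof. by move=> f; apply: val_inj; apply/funext => r /=; rewrite mulr1. Qed.

Lemma homZ_scaleDr : right_distributive homZ_scale +%R.
Proof. by move=> a f g; apply: val_inj; apply/funext. Qed.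

Lemma homZ_scaleDl (f : homZ D) : {morph homZ_scale^~ f : a b / a + b}.
Proof.
move=> a b; apply: val_inj; apply/funext => r /=.
rewrite -[RHS]/(val f (r * a) + val f (r * b)) mulrDr.
exact/zmod_morphismD/homZ_additive.
Qed.

HB.instance Definition _ := GRing.Zmodule_isLmodule.Build R (homZ D)
  homZ_scaleA homZ_scale1 homZ_scaleDr homZ_scaleDl.

Lemma homZ_evalE (f : homZ D) r : val f r = val (r *: f) 1.
Proof. by rewrite /= mul1r. Qed.

(* The adjunction Hom_Z(B, D) = Hom_R(B, Hom_Z(R, D)). *)
Lemma homZ_adjoint B (f : B -> D) : zmod_morphism f ->
  exists h : {linear B -> homZ D}, forall b r, val (h b) r = f (r *: b).
Proof.
move=> fB; have ha b : (fun r => f (r *: b)) \in @add_map D.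
  by apply/asboolP => x y; rewrite scalerBl fB.
have hl : linear (fun b => Sub (fun r => f (r *: b)) (ha b) : homZ D).
  move=> a u v; apply: val_inj; apply/funext => r /=.
  rewrite -[RHS]/(f ((r * a) *: u) + f (r *: v)).
  by rewrite scalerDr scalerA (zmod_morphismD fB).
by exists (lin_of hl).
Qed.

End Scale.

Lemma injective_cogenerator_exists : exists W : lmodType R, injective_mod W /\
  forall V (S : V -> Prop) x, lin_closed S -> ~ S x ->
    exists h : {linear V -> W}, (forall y, S y -> h y = 0) /\ h x <> 0.
Proof.
have [D [divD torD]] := divisible_cogenerator_exists.
exists (homZ D : lmodType R); split=> [A B i g inji|V S x [S0 SP] nSx].
  (* By adjunction it suffices to extend the additive map obtained from [g] by evaluation at 1. *)
  have [|f [fB fE]] := @partial_hom_extends B D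
      (fun z => exists a, z = (i a, val (g a) 1)) divD.
    split; first split.
    - by exists 0; rewrite !linear0.
    - by move=> _ _ [a ->] [b ->]; exists (a - b); rewrite !linearB.
    move=> d [a [/esym]]; rewrite -(linear0 i) => /inji->.
    by rewrite linear0.
  have [h hE] := homZ_adjoint fB; exists h => a.
  apply: val_inj; apply/funext => r; rewrite hE -linearZ homZ_evalE -linearZ /=.
  by apply: fE; exists (r *: a).
have gS : subgroup S.
  by split=> // u v Su Sv; rewrite -scaleN1r addrC; exact: SP.
have [m mE] := multiples_in_subgroup x gS.
(* Since [x] is not in [S], [m] is not a unit. As [m] kills [c], sending [S] to 0 and [x] to [c] is
   well defined. *)
have [|c [c0 cm]] := torD m.
  apply/eqP=> m1; apply: nSx; rewrite -[x]mulr1z; apply/mE.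
  by rewrite dvdz1 -eqz_nat abszE m1.
have [|f [fB fE]] := @partial_hom_extends V D
    (fun z => exists l k, S l /\ z = (l + x *~ k, c *~ k)) divD.
  split; first split.
  - by exists 0, 0; rewrite !mulr0z addr0.
  - move=> _ _ [l [k [Sl ->]]] [l' [k' [Sl' ->]]]; exists (l - l'), (k - k').
    by split; [exact: gS.2 | rewrite !mulrzBr addrACA -opprD].
  move=> d [l [k [Sl [/esym e ->]]]].
  have /mE/dvdzP[q ->] : S (x *~ k).
    rewrite -[x *~ k](addKr l) e addr0 -sub0r; exact: gS.2.
  by rewrite mulrC mulrzA cm mul0rz.
have [h hE] := homZ_adjoint fB; exists h; split=> [y Sy|hx0].
  apply: val_inj; apply/funext => r; rewrite hE.
  apply: fE; exists (r *: y), 0; rewrite !mulr0z addr0; split=> //.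
  by rewrite -[r *: y]addr0; exact: SP.
case/eqP: c0; have := hE x 1; rewrite hx0 scale1r => e.
rewrite -[RHS]/(val (0 : homZ D) 1) e.
by apply/esym/fE; exists 0, 1; rewrite add0r !mulr1z.
Qed.

Lemma fun_injective (T : Type) N : injective_mod N ->
  injective_mod (T -> N : lmodType R).
Proof.
move=> injN A B i g inji.
have ev t : exists h : {linear B -> N}, forall x, h (i x) = g x t.
  have gl : linear (fun a => g a t) by move=> a u v; rewrite linearP.
  exact: injN (lin_of gl) inji.
have [h hE] := choice ev.
have hl : linear (fun b t => h t b).
  by move=> a u v; apply/funext => t; rewrite linearP.
by exists (lin_of hl) => x; apply/funext => t /=.
Qed.

(** The quotient is the image of [B] in a power of [W] indexed by the functionals killing the image
    of [i]; separation by [W] shows that nothing more is killed. *)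
Lemma cokernel_exists A B (i : {linear A -> B}) : injective i ->
  exists C (p : {linear B -> C}), short_exact i p.
Proof.
move=> inji; have [W [_ sep]] := injective_cogenerator_exists.
pose T := {h : {linear B -> W} | forall a, h (i a) = 0}.
have fl : linear (fun b (h : T) => sval h b).
  by move=> a u v; apply/funext => h; rewrite linearP.
have [C [q [j [sq injj jE]]]] := im_factor (lin_of fl).
exists C, q; split=> // b; split=> [qb0|[a <-]].
  apply: contrapT => nb.
  have [||h [h0 hb]] := sep B (fun y => exists a, i a = y) b => //.
    split=> [|a _ _ [u <-] [v <-]]; first by exists 0; rewrite linear0.
    by exists (a *: u + v); rewrite linearP.
  have hi a : h (i a) = 0 by apply: h0; exists a.
  apply: hb; have := jE b; rewrite qb0 linear0.
  by move=> /(congr1 (fun u : T -> W => u (exist _ h hi))) /= <-.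
apply: injj; rewrite jE linear0; apply/funext => h /=; exact: (svalP h).
Qed.

(** Evaluation embeds [N] into the power of [W] indexed by its functionals. *)
Lemma enough_injectives N : exists (I : lmodType R) (i : {linear N -> I}),
  injective_mod I /\ injective i.
Proof.
have [W [injW sep]] := injective_cogenerator_exists.
have fl : linear (fun x (h : {linear N -> W}) => h x).
  by move=> a u v; apply/funext => h; rewrite linearP.
exists ({linear N -> W} -> W : lmodType R), (lin_of fl).
split=> [|x y xy]; first exact: fun_injective.
apply: contrapT => nxy.
have [||h [_]] := sep N (fun z => z = 0) (x - y).
- by split=> // a _ _ -> ->; rewrite scaler0 addr0.
- by move/subr0_eq.
by case; move/(congr1 (fun u : {linear N -> W} -> W => u h)): xy => /= hxy;
  rewrite linearB /= hxy subrr.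
Qed.

End Injectives.

(** * Finitely n-presented modules and their syzygies *)

Section FinitelyPresented.
Variable R : pzRingType.
Implicit Types A B C E F K L M N P Q V : lmodType R.

Lemma FP0_of_surj m M (p : {linear 'rV[R]_m -> M}) : surj p -> FP R 0 M.
Proof. by move=> sp; exists (fun=> m), (fun=> idfun : {linear _ -> _}), p. Qed.

(** Dropping the first free module leaves a resolution of [K], augmented by the corestriction [q] of
    the first differential. *)
Lemma FP_presentation n M : FP R n.+1 M ->
  exists m (p : {linear 'rV[R]_m -> M}) K (i : {linear K -> 'rV[R]_m}),
    short_exact i p /\ FP R n K.
Proof.
move=> [m [d [e [se e0 ek]]]]; have [K [i ip]] := ker_ses se.
exists (m 0%N), e, K, i; split=> //; have [inji exi _] := ip.
have [|q qE] := @lift_inj R _ _ _ i (d 0%N) inji.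
  by move=> x; apply/exi/e0 => //; exists x.
have q0 x : q x = 0 <-> d 0%N x = 0.
  rewrite -qE; split=> [->|]; first exact: linear0.
  by rewrite -[RHS](linear0 i) => /inji.
exists (fun k => m k.+1), (fun k => d k.+1), q; split=> [y|n0 x|k kn].
- have /exi/e0[//|a da] : exists x, i x = i y by exists y.
  by exists a; apply: inji; rewrite qE.
- by rewrite q0; exact: ek.
- exact: ek.
Qed.

Lemma FP_of_presentation n m M K (i : {linear K -> 'rV[R]_m})
    (p : {linear 'rV[R]_m -> M}) :
  short_exact i p -> FP R n K -> FP R n.+1 M.
Proof.
move=> [inji exi sp] [r [d [e [se e0 ek]]]].
pose r' k := if k is k'.+1 then r k' else m.
exists r', (fun k => match k return {linear 'rV[R]_(r' k.+1) -> 'rV[R]_(r' k)} with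
  0%N => i \o e : {linear _ -> _} | k'.+1 => d k' end), p.
split=> // [_ x|[n0 x|k]]; last exact: ek.
  rewrite exi; split=> [[y <-]|[y <-]]; last by exists (e y).
  by have [z <-] := se y; exists z.
rewrite -(e0 n0) /=; split=> [|->]; last exact: linear0.
by rewrite -[RHS](linear0 i) => /inji.
Qed.

Lemma FP_S n M : FP R n.+1 M -> FP R n M.
Proof.
move=> [m [d [e [se e0 ek]]]]; exists m, d, e; split=> // [_|k kn].
  exact: e0.
by apply: ek; exact: ltnW.
Qed.

Lemma FP1_FP n M : FP R n.+1 M -> FP R 1 M.
Proof. by elim: n => // n IH /FP_S. Qed.

Lemma FPinf_FP n M : FPinf R M -> FP R n M.
Proof. by move=> [m [d [e [se e0 ek]]]]; exists m, d, e; split. Qed.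

Lemma coherent_FPinf n M : n_coherent R n -> FP R n M -> FPinf R M.
Proof.
move=> coh; apply: (@resolution_exists R nat (fun m => 'rV[R]_m) (FP R n)).
by move=> L /coh; exact: FP_presentation.
Qed.

(** * Ext along short exact sequences, and syzygies of left orthogonals *)

Lemma ext1z_injective M N : injective_mod N -> ext1z M N.
Proof. by move=> injN P K i p _ [inji _ _] f; exact: injN. Qed.

(** Extend [p \o f] to [P], lift it to [E] by projectivity, and correct the error, which takes
    values in [A]. *)
Lemma ext1z_extension M A E C (i : {linear A -> E}) (p : {linear E -> C}) :
  short_exact i p -> ext1z M A -> ext1z M C -> ext1z M E.
Proof.
move=> [inji exi sp] eA eC P K j q prP jq f.
have [g gE] := eC _ _ _ _ prP jq (p \o f).
have [h hE] := prP _ _ p g sp.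
have [|u uE] := @lift_inj _ _ _ _ i (f \- (h \o j)) inji.
  by move=> x; apply/exi; rewrite /= linearB /= hE gE subrr.
have [v vE] := eA _ _ _ _ prP jq u.
by exists ((i \o v) \+ h) => x; rewrite /= vE uE /= subrK.
Qed.

(* [Ext^1(M, E) -> Ext^1(M, C) -> Ext^2(M, A) = Ext^1(K, A)] is exact. *)
Lemma ext1z_cokernel M A E C (i : {linear A -> E}) (p : {linear E -> C})
    P K (j : {linear K -> P}) (q : {linear P -> M}) :
  projective P -> short_exact j q -> short_exact i p ->
  ext1z K A -> ext1z M E -> ext1z M C.
Proof.
move=> prP jq [inji exi sp] eA eE; apply: (ext1z_of_presentation prP jq) => f.
(* Lift [f \o s] to [g] through [p]. On [L] it lands in [A]; subtracting an extension [v] of that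
   restriction makes it descend to a lift [h] of [f] to [E], which then extends to [P]. *)
have [Q [s [prQ ss]]] := enough_projectives K; have [L [t ts]] := ker_ses ss.
have [g gE] := prQ _ _ p (f \o s) sp; have [injt ext _] := ts.
have s0 x : s (t x) = 0 by apply/ext; exists x.
have [|u uE] := @lift_inj _ _ _ _ i (g \o t) inji.
  by move=> x; apply/exi; rewrite /= gE /= s0 linear0.
have [v vE] := eA _ _ _ _ prQ ts u.
have [|h hE] := @factor_surj _ _ _ _ s (g \- (i \o v)) ss.
  by move=> x /ext[y <-]; rewrite /= vE uE subrr.
have [w wE] := eE _ _ _ _ prP jq h.
exists (p \o w) => x /=; rewrite wE; have [y <-] := ss x.
rewrite hE /= linearB /= gE /=.
have -> : p (i (v y)) = 0 by apply/exi; exists (v y).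
by rewrite subr0.
Qed.

(** With [C] the cokernel of an embedding of [N] into an injective, Ext^1(K, N) = Ext^2(M, N) =
    Ext^1(M, C), and [C] stays in [X]. *)
Lemma perp_left_syzygy (X : mclass R) M P K (i : {linear K -> P})
    (p : {linear P -> M}) :
  coresolving R X -> projective P -> short_exact i p ->
  perp_left R X M -> perp_left R X K.
Proof.
move=> [Xinj _ Xcok] prP ip perpM N XN; apply/Ext_zero1P => Q L t s prQ [injt ext ss] f.
have [I [j [injI injj]]] := enough_injectives N.
have [C [c jc]] := cokernel_exists injj; have [_ exj sc] := jc.
have cj x : c (j x) = 0 by apply/exj; exists x.
have XC : X C by apply: (Xcok _ _ _ j c) => //; exact: Xinj.
have [g gE] := injI _ _ t (j \o f) injt.
have [|u uE] := @factor_surj _ _ _ _ s (c \o g) ss.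
  by move=> x /ext[y <-]; rewrite /= gE /= cj.
have /Ext_zero1P eMC := perpM _ XC.
have [v vE] := eMC _ _ _ _ prP ip u.
have [w wE] := prP _ _ c v sc.
(* Subtracting the part coming from [P] pushes [g] into [N] and leaves it unchanged on [L], which
   [s] kills. *)
have [|h hE] := @lift_inj _ _ _ _ j (g \- (w \o i \o s)) injj.
  by move=> x; apply/exj; rewrite /= linearB /= wE vE uE subrr.
exists h => x; apply: injj; rewrite hE /= gE /=.
have -> : s (t x) = 0 by apply/ext; exists x.
by rewrite (linear0 i) (linear0 w) subr0.
Qed.

Lemma perp_left_extz (X : mclass R) k M N :
  coresolving R X -> perp_left R X M -> X N -> extz k M N.
Proof.
move=> cX; elim: k M => [|k IH] M pM XN; first exact/Ext_zero1P/pM.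
by move=> P K i p prP ip; apply: IH => //; exact: perp_left_syzygy ip pM.
Qed.

(** * Finite presentation from vanishing of Ext *)

Lemma fg_ext1z_FP1 M : FP R 0 M ->
  (forall N, Cinj R (FP R 1) N -> ext1z M N) -> FP R 1 M.
Proof.
move=> [m [_ [p [sp _ _]]]] eM; move: (m 0%N) p sp => {}m p sp.
have [L [i ip]] := ker_ses sp; apply: (FP_of_presentation ip).
have [W [injW sep]] := injective_cogenerator_exists R.
pose T := {linear L -> W}.
(* A list [l] of generators stands for a finitely generated submodule of [L]. *)
pose kills (l : seq L) (h : T) := forall x, x \in l -> h x = 0.
pose vanish l (y : T -> W) := forall h, kills l h -> y h = 0.
have vanishS l l' y : {subset l <= l'} -> vanish l y -> vanish l' y.
  by move=> ll' v h kh; apply: v => x /ll'; exact: kh.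
have vanishP l a u v : vanish l u -> vanish l v -> vanish l (a *: u + v).
  move=> lu lv h kh; rewrite -[LHS]/(a *: u h + v h) lu // lv //.
  by rewrite scaler0 addr0.
have [|N [j [injj jE]]] :=
    @submodule_exists R (T -> W) (fun y => exists l, vanish l y).
  split=> [|a u v [l lu] [l' lv]]; first by exists [::].
  exists (l ++ l'); apply: vanishP; [apply: vanishS lu|apply: vanishS lv] => x xl;
    by rewrite mem_cat xl ?orbT.
have common r (f : {linear 'rV[R]_r -> N}) : exists l, forall v, vanish l (j (f v)).
  have /choice[l lE] (k : 'I_r) : exists l, vanish l (j (f (delta_mx 0 k))).
    by apply/jE; exists (f (delta_mx 0 k)).
  exists (flatten [seq l k | k <- enum 'I_r]) => v.
  rewrite (row_sum_delta v) !linear_sum.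
  apply: (big_ind (vanish _)) => [//|x y xv yv|k _].
    by rewrite -[x]scale1r; exact: vanishP.
  rewrite !linearZ /= -[_ *: _]addr0; apply: vanishP => //.
  apply: vanishS (lE k) => x xl; apply/flattenP; exists (l k) => //.
  by apply: map_f; rewrite mem_enum.
have Ninj : Cinj R (FP R 1) N.
  move=> F /FP_presentation[r [q [K [t [tq fgK]]]]]; apply/Ext_zero1P.
  apply: (ext1z_of_presentation (@row_projective R r) tq) => f.
  have [n' [_ [s [ss _ _]]]] := fgK; have [l lE] := common _ (f \o s).
  have [injt _ _] := tq; have [g gE] := fun_injective injW (j \o f) injt.
  (* Zeroing the coordinates that kill [l] brings [g] into [N]; on [K] nothing changes, because [f]
     already vanishes at those coordinates. *)
  pose g' (v : 'rV[R]_r) (h : T) := if `[< kills l h >] then 0 else g v h.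
  have gl : linear g'.
    move=> a u v; apply/funext => h; rewrite /g'.
    rewrite -[RHS]/(a *: (if `[< kills l h >] then 0 else g u h) +
                    (if `[< kills l h >] then 0 else g v h)).
    by case: ifP => _; rewrite ?scaler0 ?addr0 // linearP.
  have [|u uE] := @lift_inj _ _ _ _ j (lin_of gl) injj.
    by move=> v; apply/jE; exists l => h kh /=; rewrite /g' (asboolT kh).
  exists u => x; apply: injj; rewrite uE /=; apply/funext => h; rewrite /g'.
  case: asboolP => kh; last by rewrite gE.
  by have [y <-] := ss x; rewrite (lE y).
have evl : linear (fun x (h : T) => h x).
  by move=> a u v; apply/funext => h; rewrite linearP.
have [|ev evE] := @lift_inj _ _ _ _ j (lin_of evl) injj.
  by move=> x; apply/jE; exists [:: x] => h kh; apply: kh; rewrite inE.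
have [g gE] := eM N Ninj _ _ _ _ (@row_projective R m) ip ev.
have [l lE] := common _ g.
(* The image of [s] is the span of [l]. A point [x] outside it would be detected by some [h] killing
   [l], while [lE] forces [h x = 0]. *)
have [s sE] := (row_basis R (size l)).1 L (fun k => l`_k).
apply: (FP0_of_surj (p := s)) => x; apply: contrapT => nx.
have [||h [h0 hx]] := sep L (fun y => exists v, s v = y) x => //.
  split=> [|a _ _ [u <-] [v <-]]; first by exists 0; rewrite linear0.
  by exists (a *: u + v); rewrite linearP.
apply: hx; rewrite -[LHS]/(lin_of evl x h) -evE -gE; apply: lE => y yl.
apply: h0; exists (delta_mx 0 (Ordinal (etrans (index_mem y l) yl))).
by rewrite sE /= nth_index.
Qed.

(** Passing to a syzygy lowers the degree of Ext and the level of presentation together, down to the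
    finitely generated case. *)
Lemma extz_FP_S k M : FP R k M ->
  (forall N, Cinj R (FP R 1) N -> extz k M N) -> FP R k.+1 M.
Proof.
elim: k M => [|k IH] M FPM eM; first exact: fg_ext1z_FP1.
have [m [p [K [i [ip FPK]]]]] := FP_presentation FPM.
apply: (FP_of_presentation ip); apply: IH => // N /eM eN.
exact: eN (@row_projective R m) ip.
Qed.

End FinitelyPresented.

(** * The cycle of implications from (1) through (6) back to (1) *)

Theorem theorem5p5 (R : pzRingType) (n : nat) (hn : (1 <= n)%N) :
  [<-> n_coherent R n;
       same_class R (Cinj R (FP R n)) (Cinj R (FPinf R));
       same_class R (Cinj R (FP R n)) (Cinj R (FP R n.+1));
       coresolving R (Cinj R (FP R n));
       hereditary_cotorsion_pair R (perp_left R (Cinj R (FP R n))) (Cinj R (FP R n));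
       forall (k : nat) (M N : lmodType R), (1 < k)%N -> FP R n M ->
         Cinj R (FP R n) N -> Ext_zero R k M N].
Proof.
tfae.
- move=> coh N; split=> NI F FF; apply: NI; first exact: FPinf_FP.
  exact: coherent_FPinf FF.
(* The FP_{n+1}-injectives lie between the two classes that (2) identifies. *)
- move=> eqI N; split=> NI; first by move=> F /FP_S; exact: NI.
  by apply/eqI => F FF; apply: NI; exact: FPinf_FP.
- move=> eqI; split=> [N injN F FF|A E C i p ip AI CI F FF|A E C i p ip AI EI].
  + exact/Ext_zero1P/ext1z_injective.
  + apply/Ext_zero1P/(ext1z_extension ip); apply/Ext_zero1P; [exact: AI | exact: CI].
  (* By (3) only [F] in [FP R n.+1] has to be tested, and its syzygy [K] lies in [FP R n], so
     Ext^1(K, A) = 0. *)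
  + apply/eqI => F FF; have [m [q [K [j [jq FK]]]]] := FP_presentation FF.
    apply/Ext_zero1P/(ext1z_cokernel (@row_projective R m) jq ip); apply/Ext_zero1P.
      exact: AI.
    by apply: EI; exact: FP_S.
- move=> cor; split; last first.
    by case=> // k X N _ pX NI; apply: extz_Ext_zero; exact: perp_left_extz cor pX NI.
  (* Modules in [FP R n] belong to the left orthogonal, so its right orthogonal is no larger than
     the original class. *)
  split=> // N; split=> [NI F FF|NI X]; last by apply.
  by apply: NI => N' N'I; exact: N'I.
- move=> [_ her] k M N k1 FM NI; apply: her => //; first exact: ltnW.
  by move=> N' N'I; exact: N'I.
- move=> ext M FM; apply: extz_FP_S => // N NI.
  (* The degree is [n.+1], above 1 since [n] is positive; for the same reason FP_1-injectives are
     FP_n-injective. *)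
  apply: Ext_zero_extz; apply: ext => // F FF; apply: NI.
  by case: n hn FF {FM} => // n' _; exact: FP1_FP.
Qed.
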